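(* Let the structural assumptions (A1)–(A5) listed in the context hold at $\hat u=(\hat x,\hat y)\in H^{-1}(0)$ for some $L\ge 0$, $R_K>0$, $\lambda\ge 0$, $\theta\ge0$, $p\in[1,2]$, and $\rho_y\ge 0$, with $\tilde\gamma_G>0$, where the iterates $u^i=(x^i,y^i)$ are generated by the NL-PDHGM algorithm (see context) with parameters $$\tau_{i+1}=\tau_i\omega_i,\qquad \sigma_{i+1}=\sigma_i/\omega_i,\qquad \omega_i=1/\sqrt{1+2\tau_i\tilde\gamma_G}\qquad(i\in\mathbb N),$$ where, for some $0<\delta\le\kappa<1$, $$0<\tau_0\le\frac{\delta}{3L\rho_y+\lambda}\quad\text{and}\quad 0<\tau_0\sigma_0\le\frac{1-\kappa}{R_K^2}.$$ Suppose moreover that for some $\zeta>0$ $$\gamma_{\mathrm{NL}}\ge(p-1)\zeta\quad\text{and}\quad\theta\ge\rho_y^{2-p}p^{-p}\sqrt{1+2\tau_0\tilde\gamma_G}\,\zeta^{1-p}.$$ Then $\|x^N-\hat x\|^2$ converges to zero at the rate $O(1/N^2)$.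
   Context: $X,Y$ are Hilbert spaces; $G:X\to(-\infty,\infty]$ and $F^*:Y\to(-\infty,\infty]$ are convex, proper and lower semicontinuous; $K\in C^1(X;Y)$ is a possibly nonlinear operator with Fréchet derivative $\nabla K(x)$. For a bounded operator $T$, $\|x\|_T^2:=\langle Tx,x\rangle$. The set-valued map $H:X\times Y\rightrightarrows X\times Y$ is $$H(x,y)=\begin{pmatrix}\partial G(x)+[\nabla K(x)]^*y\\ \partial F^*(y)-K(x)\end{pmatrix},\qquad H^{-1}(0)=\{u: 0\in H(u)\}.$$ NL-PDHGM algorithm: given a starting point $(x^0,y^0)$ and $\tau_i,\sigma_{i+1},\omega_i>0$, for $i=0,1,2,\dots$ $$x^{i+1}=(I+\tau_i\partial G)^{-1}(x^i-\tau_i[\nabla K(x^i)]^*y^i),\quad \bar x^{i+1}=x^{i+1}+\omega_i(x^{i+1}-x^i),\quad y^{i+1}=(I+\sigma_{i+1}\partial F^* )^{-1}(y^i+\sigma_{i+1}K(\bar x^{i+1})).$$ Subspaces: $Y_{\mathrm L}:=\{y\in Y: x\mapsto\langle y,K(x)\rangle\text{ is linear}\}$, $Y_{\mathrm{NL}}:=Y_{\mathrm L}^\perp$; $P_{\mathrm L},P_{\mathrm{NL}}$ are the orthogonal projections onto them; $\mathbb B_{\mathrm{NL}}(\hat y,r):=\{y\in Y:\|y-\hat y\|_{P_{\mathrm{NL}}}\le r\}$. A set-valued map $A$ on a Hilbert space is $\Gamma$-strongly monotone at $\hat v$ for $\hat w\in A(\hat v)$ in a neighborhood $\mathcal V$ of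 $\hat v$ if $\langle w-\hat w,v-\hat v\rangle\ge\|v-\hat v\|_\Gamma^2$ for all $v\in\mathcal V$, $w\in A(v)$ (here $\Gamma\ge 0$). Structural assumptions at $\hat u=(\hat x,\hat y)\in H^{-1}(0)$, with $\mathcal X_K$ and $\mathcal X_G$ neighborhoods of $\hat x$, $\mathcal Y_{F^*}$ a neighborhood of $\hat y$, constants $\gamma_G,\tilde\gamma_G,\gamma_{\mathrm L},\gamma_{\mathrm{NL}}\ge 0$, and $\mathcal U(\rho_y):=(\mathcal X_G\cap\mathcal X_K)\times(\mathbb B_{\mathrm{NL}}(\hat y,\rho_y)\cap\mathcal Y_{F^*})$: (A1) $\|\nabla K(x)-\nabla K(x')\|\le L\|x-x'\|$ for all $x,x'\in\mathcal X_K$. (A2) $\sup_{x\in\mathcal X_K}\|\nabla K(x)\|\le R_K$. (A3) $\partial G$ is $\gamma_G I$-strongly monotone at $\hat x$ for $-[\nabla K(\hat x)]^*\hat y$ in $\mathcal X_G$, and $\partial F^*$ is $(\gamma_{\mathrm L}P_{\mathrm L}+\gamma_{\mathrm{NL}}P_{\mathrm{NL}})$-strongly monotone at $\hat y$ for $K(\hat x)$ in $\mathcal Y_{F^*}$. (A4) For all $x,x'\in\mathcal X_K$: $\langle[\nabla K(x')-\nabla K(\hat x)]^*\hat y,x-\hat x\rangle+(\gamma_G-\tilde\gamma_G)\|x-\hat x\|^2\ge\theta\|K(\hat x)-K(x)-\nabla K(x)(\hat x-x)\|^p-\frac{\lambda}{2}\|x-x'\|^2$. (A5) The iterates satisfy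 $u^i\in\mathcal U(\rho_y)$ and $\bar x^{i+1}\in\mathcal X_K$ for all $i\in\mathbb N=\{0,1,2,\dots\}$. Conventions: $0^0=1$; $\delta/(3L\rho_y+\lambda)$ is read as $+\infty$ if the denominator is $0$. *)

(* Defs.v *)
From HB Require Import structures.
From mathcomp Require Import all_boot all_order all_algebra.
From mathcomp Require Import all_classical all_reals all_analysis.

Set Implicit Arguments.
Unset Strict Implicit.
Unset Printing Implicit Defensive.

Import Order.TTheory GRing.Theory Num.Theory.
Import numFieldNormedType.Exports.

Local Open Scope classical_set_scope.
Local Open Scope ring_scope.

HB.mixin Record CompleteNormedModule_isHilbert (R : realType) X
    & CompleteNormedModule R X := {
  inner_form : {dot X for (@idfun R)} ;
  normr_inner : forall x : X, `|x| ^+ 2 = inner_form x x }.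

#[short(type="hilbertType")]
HB.structure Definition Hilbert (R : realType) :=
  { X of CompleteNormedModule R X & CompleteNormedModule_isHilbert R X }.

Definition inner {R : realType} {X : hilbertType R} (x y : X) : R :=
  @inner_form R X x y.

Notation "'⟨' x , y '⟩'" := (inner x%R y%R)
  (at level 0, x at level 99, y at level 99, format "'⟨' x ,  y '⟩'")
  : ring_scope.

Section Operators.
Context {R : realType}.
Implicit Types X Y : hilbertType R.

(* The values are extended reals, so that an unbounded operator has norm +oo. *)
Definition opnorm X Y (T : X -> Y) : \bar R :=
  ereal_sup [set `|T x|%:E | x in [set x | `|x| <= 1]].

(* By the Riesz theorem the witness exists when T is linear and bounded, and
   it is then unique. *)
Definition adjoint X Y (T : X -> Y) (y : Y) : X :=
  get [set z | forall x, ⟨T x, y⟩ = ⟨x, z⟩].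

Definition orth X (S : set X) : set X :=
  [set z | forall s, S s -> ⟨z, s⟩ = 0].

(* The witness exists, and is unique, when S is a closed linear subspace. *)
Definition orthoproj X (S : set X) (v : X) : X :=
  get [set z | S z /\ orth S (v - z)].

Definition sqnorm X (T : X -> X) (v : X) : R := ⟨T v, v⟩.

Definition C1 X Y (K : X -> Y) : Prop :=
  (forall x, differentiable K x) /\
  (forall x, opnorm ('d K x' \- 'd K x) @[x' --> x] --> 0%E).

End Operators.

Section ConvexAnalysis.
Context {R : realType} {X : hilbertType R}.

Definition proper_efun (f : X -> \bar R) : Prop :=
  (forall x, f x != -oo%E) /\ (exists x, (f x < +oo)%E).

(* The convention 0 * +oo = 0 makes the cases t = 0 and t = 1 trivial. *)
Definition convex_efun (f : X -> \bar R) : Prop :=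
  forall (x y : X) (t : R), 0 <= t <= 1 ->
    (f (t *: x + (1 - t) *: y)%R <= t%:E * f x + (1 - t)%:E * f y)%E.

(* For proper f this is empty where f is +oo. *)
Definition subdiff (f : X -> \bar R) (x : X) : set X :=
  [set g | forall z, (f x + ⟨g, z - x⟩%:E <= f z)%E].

(* The set-valued inverse (I + tau A)^-1; for A the subdifferential of a proper
   convex lower semicontinuous function its values are singletons. *)
Definition resolvent (tau : R) (A : X -> set X) (v : X) : set X :=
  [set x | exists2 g, A x g & v = x + tau *: g].

Definition strongly_monotone (A : X -> set X) (Gamma : X -> X)
    (v0 w0 : X) (V : set X) : Prop :=
  A v0 w0 /\
  forall v w, V v -> A v w -> ⟨w - w0, v - v0⟩ >= sqnorm Gamma (v - v0).

End ConvexAnalysis.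

Section SaddlePoint.
Context {R : realType} {X Y : hilbertType R}.
Variables (G : X -> \bar R) (Fs : Y -> \bar R) (K : X -> Y).

Definition saddle_map (u : X * Y) : set (X * Y) :=
  [set w | exists xi eta, [/\ subdiff G u.1 xi, subdiff Fs u.2 eta &
     w = (xi + adjoint ('d K (u.1)) u.2, eta - K u.1)]].

Definition saddle_zeros : set (X * Y) := [set u | saddle_map u 0].

Definition YL : set Y := [set y | scalar (fun x => ⟨y, K x⟩)].

Definition YNL : set Y := orth YL.

Definition PL : Y -> Y := orthoproj YL.

Definition PNL : Y -> Y := orthoproj YNL.

Definition ballNL (y0 : Y) (r : R) : set Y :=
  [set y | Num.sqrt (sqnorm PNL (y - y0)) <= r].

(* [xbar omega x i] is the extrapolated point with index i + 1. *)
Definition xbar (omega : nat -> R) (x : nat -> X) (i : nat) : X :=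
  x i.+1 + omega i *: (x i.+1 - x i).

Definition NL_PDHGM (tau sigma omega : nat -> R) (x : nat -> X) (y : nat -> Y)
    : Prop :=
  forall i : nat,
  [/\ 0 < tau i, 0 < sigma i.+1 & 0 < omega i] /\
  resolvent (tau i) (subdiff G)
    (x i - tau i *: adjoint ('d K (x i)) (y i)) (x i.+1) /\
  resolvent (sigma i.+1) (subdiff Fs)
    (y i + sigma i.+1 *: K (xbar omega x i)) (y i.+1).

End SaddlePoint.

(* Main.v *)
(* With [eta i = 1 / tau i], the quantity [1 / (tau i * sigma i)] does not
   depend on [i]; call it [psi]. The energy
     [E i = eta i ^+ 2 * |x i - xhat|^2 + psi * |y i - yhat|^2
            - 2 * eta i * <K'(x i) (x i - xhat), y i - yhat>]
   dominates [kappa * eta i ^+ 2 * |x i - xhat|^2] because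
   [RK ^+ 2 <= psi * (1 - kappa)], and [eta] grows at least linearly; so it is
   enough to bound [E].
   Testing the two proximal steps with the errors and using monotonicity at the
   saddle point bounds [E i.+1 - E i]. The usual argument controls
   [K (xbar i) - K (x i.+1)] by a Taylor estimate on a segment, but [XK] need
   not be convex. Instead (A4) is applied at the extrapolated point itself: the
   remainder it controls is the one that occurs in the dual step. The price is
   an error
     [eta i * (a * |x i.+1 - xhat| * |x i.+1 - x i| + b * |x i.+1 - x i|^2)],
   which for large [eta i] is absorbed by
   [kappa * eta i ^+ 2 * |x i.+1 - x i|^2] up to a multiple of
   [|x i.+1 - xhat|^2 = O(E i.+1 / eta i.+1 ^+ 2)]. As [1 / eta i ^+ 2] is
   summable, [E] remains bounded. *)

Require Import Defs.
From mathcomp Require Import all_boot all_order all_algebra.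
From mathcomp Require Import all_classical all_reals all_analysis.
From mathcomp Require Import ring lra.

Import Order.TTheory GRing.Theory Num.Theory.
Import numFieldNormedType.Exports.

Local Open Scope classical_set_scope.
Local Open Scope ring_scope.

(** * Inner product algebra and the Cauchy-Schwarz inequality *)

Section InnerProduct.
Context {R : realType} {X : hilbertType R}.
Implicit Types (u v w : X) (a : R) (S : set X).

Lemma innerDl u v w : ⟨u + v, w⟩ = ⟨u, w⟩ + ⟨v, w⟩.
Proof. exact: (linearDl (@inner_form R X)). Qed.

Lemma innerDr u v w : ⟨u, v + w⟩ = ⟨u, v⟩ + ⟨u, w⟩.
Proof. exact: (linearDr (@inner_form R X)). Qed.

Lemma innerNl u v : ⟨- u, v⟩ = - ⟨u, v⟩.
Proof. exact: (linearNl (@inner_form R X)). Qed.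

Lemma innerNr u v : ⟨u, - v⟩ = - ⟨u, v⟩.
Proof. exact: (linearNr (@inner_form R X)). Qed.

Lemma innerZl a u v : ⟨a *: u, v⟩ = a * ⟨u, v⟩.
Proof. exact: (linearZl_LR (@inner_form R X)). Qed.

Lemma innerZr a u v : ⟨u, a *: v⟩ = a * ⟨u, v⟩.
Proof. exact: (linearZr_LR (@inner_form R X)). Qed.

Lemma innerBl u v w : ⟨u - v, w⟩ = ⟨u, w⟩ - ⟨v, w⟩.
Proof. by rewrite innerDl innerNl. Qed.

Lemma innerBr u v w : ⟨u, v - w⟩ = ⟨u, v⟩ - ⟨u, w⟩.
Proof. by rewrite innerDr innerNr. Qed.

Lemma innerC u v : ⟨u, v⟩ = ⟨v, u⟩.
Proof.
by rewrite /inner (hermitian_subproof (s := @inner_form R X)) expr0 mul1r.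
Qed.

Lemma inner0l u : ⟨0, u⟩ = 0.
Proof. by rewrite -(scale0r 0) innerZl mul0r. Qed.

Lemma inner0r u : ⟨u, 0⟩ = 0.
Proof. by rewrite innerC inner0l. Qed.

Lemma innervv u : ⟨u, u⟩ = `|u| ^+ 2.
Proof. by rewrite normr_inner. Qed.

Lemma sqr_normD u v : `|u + v| ^+ 2 = `|u| ^+ 2 + 2 * ⟨u, v⟩ + `|v| ^+ 2.
Proof. rewrite -!innervv !innerDl !innerDr (innerC v u); ring. Qed.

Lemma sqr_normB u v : `|u - v| ^+ 2 = `|u| ^+ 2 - 2 * ⟨u, v⟩ + `|v| ^+ 2.
Proof. rewrite sqr_normD innerNr normrN; ring. Qed.

Lemma parallelogram u v :
  `|u + v| ^+ 2 + `|u - v| ^+ 2 = 2 * `|u| ^+ 2 + 2 * `|v| ^+ 2.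
Proof. rewrite sqr_normD sqr_normB; ring. Qed.

Lemma cauchy_schwarz u v : `|⟨u, v⟩| <= `|u| * `|v|.
Proof.
have [->|v0] := eqVneq v 0; first by rewrite inner0r !normr0 mulr0.
have V0 : 0 < `|v| by rewrite normr_gt0.
(* This vector is [|v|^2] times the component of [u] orthogonal to [v]; the scaling avoids a
   division. *)
have := sqr_ge0 `|(`|v| ^+ 2) *: u - ⟨u, v⟩ *: v|.
rewrite sqr_normB innerZl innerZr !normrZ !exprMn normr_id.
rewrite real_normK ?num_real// => h.
have {}h : 0 <= `|v| ^+ 2 * (`|v| ^+ 2 * `|u| ^+ 2 - ⟨u, v⟩ ^+ 2).
  apply: le_trans h _; rewrite le_eqVlt; apply/orP; left; apply/eqP; ring.
rewrite pmulr_rge0 ?exprn_gt0// subr_ge0 in h.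
rewrite -(@ler_pXn2r _ 2)// ?nnegrE ?mulr_ge0//.
by rewrite real_normK ?num_real// exprMn mulrC.
Qed.

Lemma inner_continuousl v : continuous (fun u => ⟨u, v⟩).
Proof.
move=> u; apply/cvgrPdist_lt => e e0.
near=> w; rewrite -innerBl (le_lt_trans (cauchy_schwarz _ _))//.
(* Adding 1 keeps the divisor positive when [v] is 0. *)
apply: (@le_lt_trans _ _ (`|u - w| * (`|v| + 1))).
  by rewrite ler_wpM2l// lerDl.
rewrite -ltr_pdivlMr ?ltr_wpDl//.
by near: w; apply: cvgr_dist_lt => //; rewrite divr_gt0// ltr_wpDl.
Unshelve. all: by end_near. Qed.

End InnerProduct.

(** * Closed subspaces and orthogonal projections *)

Definition closed_subspace {R : realType} {X : hilbertType R} (S : set X) :=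
  [/\ S 0, (forall (a : R) u v, S u -> S v -> S (a *: u + v)) & closed S].

Section Projection.
Context {R : realType} {X : hilbertType R}.
Implicit Types (u v w p : X) (S : set X).

(** [S] is an arbitrary set, so that [YL] can later be shown to be a closed subspace by writing it
    as an orthogonal complement. *)
Lemma orth_closed_subspace S : closed_subspace (orth S).
Proof.
split.
- by move=> s _; rewrite inner0l.
- by move=> a u v Su Sv s Ss; rewrite innerDl innerZl (Su _ Ss) (Sv _ Ss) mulr0 addr0.
- have -> : orth S = \bigcap_(s in S) ((fun u => ⟨u, s⟩) @^-1` [set 0]).
    by rewrite eqEsubset; split=> z Sz s Ss; exact: Sz.
  apply: closed_bigI => s _.
  apply: preimage_closed; last exact: closed_eq.
  by move=> u _; exact: inner_continuousl.
Qed.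

Lemma nearest_point_orth S v p : closed_subspace S -> S p ->
  (forall s, S s -> `|v - p| ^+ 2 <= `|v - s| ^+ 2) -> orth S (v - p).
Proof.
move=> [_ lS _] Sp pmin s Ss.
have h t : 0 <= t ^+ 2 * `|s| ^+ 2 - 2 * t * ⟨v - p, s⟩.
  have := pmin _ (lS t _ _ Ss Sp).
  have -> : v - (t *: s + p) = (v - p) - t *: s by rewrite opprD addrA addrAC.
  rewrite (sqr_normB (v - p)) innerZr normrZ exprMn.
  rewrite real_normK ?num_real// => ?; lra.
have [s0|s0] := eqVneq `|s| 0.
  by move/normr0_eq0 : s0 => ->; rewrite inner0r.
(* The minimizer in [t] of the quadratic in [h]; its minimum is negative unless the inner product
   vanishes. *)
have := h (⟨v - p, s⟩ / `|s| ^+ 2).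
set a := ⟨_, _⟩.
have -> : (a / `|s| ^+ 2) ^+ 2 * `|s| ^+ 2 - 2 * (a / `|s| ^+ 2) * a =
  - (a ^+ 2 / `|s| ^+ 2) by field.
rewrite oppr_ge0 pmulr_lle0 ?invr_gt0 ?exprn_gt0// ?lt_def ?s0 ?normr_ge0// => a2.
by apply/eqP; rewrite -sqrf_eq0 eq_le a2 sqr_ge0.
Qed.

(** A minimizing sequence for the distance to [v] is Cauchy by the parallelogram law, because
    midpoints stay in [S]. Its limit is a nearest point, hence has an orthogonal residual. *)
Lemma projection_exists S v : closed_subspace S ->
  exists p, S p /\ orth S (v - p).
Proof.
move=> cS; have [S0 lS clS] := cS.
pose D := [set `|v - s| ^+ 2 | s in S].
have D0 : D !=set0 by exists (`|v - 0| ^+ 2); exists 0.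
have Dlb : has_lbound D by exists 0 => _ [s _ <-]; exact: sqr_ge0.
have Dinf : has_inf D by [].
pose d := inf D.
have dmin s : S s -> d <= `|v - s| ^+ 2 by move=> Ss; apply: ge_inf => //; exists s.
have /choice[s Hs] : forall n : nat, exists s, S s /\ `|v - s| ^+ 2 < d + n.+1%:R^-1.
  move=> n; have [_ [s Ss <-] sd] : exists2 e, D e & e < inf D + n.+1%:R^-1.
    by apply: inf_adherent => //; rewrite invr_gt0.
  by exists s.
have mid m n : `|s m - s n| ^+ 2 <= 2 * m.+1%:R^-1 + 2 * n.+1%:R^-1.
  have := parallelogram (v - s m) (v - s n).
  have -> : v - s m - (v - s n) = s n - s m.
    by rewrite opprB addrC addrA subrK.
  have -> : v - s m + (v - s n) = 2 *: (v - 2^-1 *: (s m + s n)).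
    by rewrite scalerBr scalerA mulfV// scale1r scaler_nat mulr2n addrACA opprD.
  have Sm : S (2^-1 *: (s m + s n)).
    rewrite -[_ *: _]addr0; apply: (lS) => //.
    by rewrite -[s m]scale1r; apply: lS; apply Hs.
  rewrite normrZ exprMn (ger0_norm (ler0n _ _)) (distrC (s n)).
  have := dmin _ Sm; have := (Hs m).2; have := (Hs n).2.
  set e := m.+1%:R^-1; set f := n.+1%:R^-1; lra.
have cau : cauchy (s @ \oo).
  apply: cauchy_exP => e e0.
  have e20 : 0 < e ^+ 2 / 4 by rewrite divr_gt0// exprn_gt0.
  have [N _ hN] : \forall n \near \oo, n.+1%:R^-1 < e ^+ 2 / 4.
    exact: near_infty_natSinv_lt (PosNum e20).
  exists (s N); exists N => // n /= Nn.
  rewrite -ball_normE /=.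
  rewrite -(@ltr_pXn2r _ 2)// ?nnegrE ?(ltW e0)//.
  apply: le_lt_trans (mid _ _) _.
  have := hN N (leqnn _); have := hN n Nn => /=.
  set a := n.+1%:R^-1; set b := N.+1%:R^-1; lra.
have [p sp] : exists p, s @ \oo --> p.
  by apply/cvg_ex; exact: (@cauchy_cvg X (s @ \oo) _ cau).
have Sp : S p.
  apply: (closed_cvg S clS _ p sp); near=> n; exact: (Hs n).1.
exists p; split=> //; apply: nearest_point_orth => // t St.
apply: le_trans (dmin _ St).
have cv : (fun n => `|v - s n| ^+ 2) @ \oo --> `|v - p| ^+ 2.
  have h : (fun n => `|v - s n|) @ \oo --> `|v - p|.
    by apply: cvg_norm; apply: cvgB sp; exact: cvg_cst.
  by rewrite expr2; under eq_fun do rewrite expr2; exact: cvgM.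
have cd : (fun n : nat => d + n.+1%:R^-1) @ \oo --> d.
  by rewrite -[X in _ --> X]addr0; apply: cvgD (cvg_cst _) _; exact: cvg_harmonic.
apply: (ler_cvg_to cv cd).
by near=> n; exact: ltW (Hs n).2.
Unshelve. all: by end_near. Qed.

Lemma orthoprojP S v : closed_subspace S ->
  S (orthoproj S v) /\ orth S (v - orthoproj S v).
Proof.
by move=> cS; have [p Hp] := projection_exists S v cS; exact: (@getI X [set z | S z /\ orth S (v - z)] p Hp).
Qed.

Lemma orthoproj_unique S v p : closed_subspace S ->
  S p -> orth S (v - p) -> orthoproj S v = p.
Proof.
move=> cS Sp op; have [Sq oq] := orthoprojP S v cS; have [_ lS _] := cS.
set q := orthoproj S v in Sq oq *.
have Sqp : S (q - p) by rewrite addrC -scaleN1r; exact: lS.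
apply/eqP; rewrite -subr_eq0 -normr_eq0 -sqrf_eq0 -innervv; apply/eqP.
have -> : ⟨q - p, q - p⟩ = ⟨v - p, q - p⟩ - ⟨v - q, q - p⟩.
  by rewrite -innerBl; congr inner; rewrite opprB [RHS]addrC addrA subrK.
by rewrite op// oq// subrr.
Qed.

Lemma orth_orthoproj S v : closed_subspace S ->
  orthoproj (orth S) v = v - orthoproj S v.
Proof.
move=> cS; have [Sp op] := orthoprojP S v cS.
apply: orthoproj_unique => //; first exact: orth_closed_subspace.
by move=> s Ss; rewrite opprB addrC subrK innerC; exact: Ss.
Qed.

Lemma inner_orthoproj S v : closed_subspace S ->
  ⟨orthoproj S v, v⟩ = `|orthoproj S v| ^+ 2.
Proof.
move=> cS; have [Sp op] := orthoprojP S v cS.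
set p := orthoproj S v in Sp op *.
have -> : ⟨p, v⟩ = ⟨v - p, p⟩ + ⟨p, p⟩ by rewrite -innerDl subrK innerC.
by rewrite op// add0r innervv.
Qed.

End Projection.

(** * Riesz representation, adjoints and operator norms *)

Section Adjoint.
Context {R : realType} {X Y : hilbertType R}.

(** The kernel of [f] is closed, so a vector outside it minus its projection is orthogonal to the
    kernel; a multiple of this difference represents [f]. *)
Lemma riesz (f : X -> R) : (forall a u v, f (a *: u + v) = a * f u + f v) ->
  continuous f -> exists z, forall u, f u = ⟨u, z⟩.
Proof.
move=> lf cf; pose S : set X := [set u | f u = 0].
have f0 : f 0 = 0 by have := lf 1 0 0; rewrite scale1r add0r mul1r => ?; lra.
have cS : closed_subspace S.
  split=> //.
  - by move=> a u v /= fu fv; rewrite /S /= lf fu fv mulr0 addr0.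
  - have -> : S = f @^-1` [set 0] by [].
    by apply: preimage_closed; [move=> u _; exact: cf | exact: closed_eq].
have [hS|/existsNP[v fv]] := pselect (forall u, f u = 0).
  by exists 0 => u; rewrite inner0r.
have [p [Sp op]] := projection_exists S v cS.
pose w := v - p.
have fw : f w = f v.
  by rewrite /w addrC -scaleN1r lf Sp mulr0 add0r.
have w0 : `|w| ^+ 2 != 0.
  rewrite sqrf_eq0 normr_eq0; apply/eqP => w0.
  by apply: fv; rewrite -fw w0.
exists ((f v / `|w| ^+ 2) *: w) => u.
(* Removing from [u] the multiple of [w] with the same value under [f] leaves an element of the
   kernel. *)
have Su : S ((- (f u / f v)) *: w + u).
  by rewrite /S /= lf fw mulNr divfK ?addNr//; exact/eqP.
have h : ⟨w, (- (f u / f v)) *: w + u⟩ = 0 := op _ Su.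
rewrite innerDr innerZr innervv in h.
rewrite innerZr (innerC u).
have -> : ⟨w, u⟩ = f u / f v * `|w| ^+ 2 by lra.
move: w0 (introN eqP fv); set N := `|w| ^+ 2; set c := f v => N0 c0.
by field; rewrite N0 c0.
Qed.

Lemma adjointE (T : X -> Y) : linear T -> continuous T ->
  forall y x, ⟨adjoint T y, x⟩ = ⟨y, T x⟩.
Proof.
move=> lT cT y x.
have [|u|z hz] := @riesz (fun x => ⟨T x, y⟩).
  by move=> a u v; rewrite lT innerDl innerZl.
exact: continuous_comp (cT u) (inner_continuousl _ _).
have h := @getI X [set z | forall x, ⟨T x, y⟩ = ⟨x, z⟩] z hz x.
by rewrite innerC -[RHS]innerC; exact/esym.
Qed.
End Adjoint.

Section BoundedOperators.
Context {R : realType} {X Y : hilbertType R}.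
Implicit Types (T : X -> Y).

Lemma opnorm_bound T (c : R) : linear T -> (opnorm T <= c%:E)%E ->
  forall x, `|T x| <= c * `|x|.
Proof.
move=> lT Tc x.
have lZ a u : T (a *: u) = a *: T u by have := GRing.scalable_linear lT a u.
have [->|x0] := eqVneq x 0.
  by rewrite -(scale0r 0) lZ !scale0r !normr0 mulr0.
have x1 : 0 < `|x| by rewrite normr_gt0.
rewrite -ler_pdivrMr// mulrC -[X in X * _]gtr0_norm ?invr_gt0// -normrZ -lZ.
rewrite -lee_fin; apply: le_trans Tc; apply: ereal_sup_ubound => /=.
exists (`|x|^-1 *: x) => //=.
by rewrite normrZ gtr0_norm ?invr_gt0// mulVf// gt_eqF.
Qed.

Lemma linear_subr T T' : linear T -> linear T' -> linear (T \- T').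
Proof.
move=> lT lT' a u v; rewrite /= lT lT'.
by rewrite opprD addrACA -scalerBr.
Qed.

End BoundedOperators.

(** * The subspaces on which [K] acts linearly and nonlinearly *)

Section NonlinearRange.
Context {R : realType} {X Y : hilbertType R} (K : X -> Y).
Implicit Types (y w v : Y).

(** Linearity of [⟨y, K x⟩] in [x] means that [y] is orthogonal to all linearity defects
    [K (a u + v) - a K u - K v]. *)
Lemma closed_subspace_YL : closed_subspace (YL K).
Proof.
have -> : YL K = orth [set K (e.1.1 *: e.1.2 + e.2) - e.1.1 *: K e.1.2 - K e.2
    | e in [set: R * X * X]].
  rewrite eqEsubset; split=> y yL.
    by move=> _ [[[a u] v] _ <-] /=; rewrite !innerBr innerZr (yL a u v) /=; ring.
  move=> a u v /=; have : ⟨y, K (a *: u + v) - a *: K u - K v⟩ = 0.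
    by apply: yL; exists (a, u, v).
  rewrite !innerBr innerZr => h; rewrite /GRing.scale /=; lra.
exact: orth_closed_subspace.
Qed.

(** Tested against [y], the difference quotients of [K] in direction [h] are constant. The result
    does not depend on the base point [a], so differences of derivatives and Taylor remainders are
    orthogonal to [YL]. *)
Lemma inner_diff_YL y a h : YL K y -> differentiable K a ->
  ⟨y, 'd K a h⟩ = ⟨y, K h⟩.
Proof.
move=> yL dK; rewrite -deriveE//.
have dKh : derivable K a h by exact: diff_derivable.
have cv := @continuous_cvg _ _ _ _ _ _ (fun u => ⟨u, y⟩) _
  (inner_continuousl y ('D_h K a)) dKh.
rewrite innerC [RHS]innerC -(cvg_lim _ (cv _))//.
apply: lim_near_cst => //; near=> t.
have t0 : t != 0 by near: t; exact: nbhs_dnbhs_neq.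
rewrite /= innerZl innerBl !(innerC (K _)) (yL t h a) /=.
by field.
Unshelve. all: by end_near. Qed.

(** This is how [rho], which bounds only the [YNL] component of the dual error, controls pairings
    with derivative differences and remainders. *)
Lemma inner_orth_YL w v : orth (YL K) w -> `|⟨w, v⟩| <= `|w| * `|PNL K v|.
Proof.
move=> wo; have [PLv _] := orthoprojP (YL K) v closed_subspace_YL.
rewrite /PNL orth_orthoproj; last exact: closed_subspace_YL.
set p := orthoproj _ v in PLv *.
have -> : ⟨w, v⟩ = ⟨w, v - p⟩ by rewrite innerBr (wo _ PLv) subr0.
exact: cauchy_schwarz.
Qed.

Lemma sqnorm_PL_ge0 v : 0 <= ⟨PL K v, v⟩.
Proof. by rewrite inner_orthoproj ?sqr_ge0//; exact: closed_subspace_YL. Qed.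

Lemma sqnorm_PNL v : ⟨PNL K v, v⟩ = `|PNL K v| ^+ 2.
Proof. exact/inner_orthoproj/orth_closed_subspace. Qed.

Lemma ballNL_norm y0 rho y : ballNL K y0 rho y -> `|PNL K (y - y0)| <= rho.
Proof. by rewrite /ballNL/= /sqnorm sqnorm_PNL sqrtr_sqr normr_id. Qed.

Lemma orth_diffB a b h : differentiable K a -> differentiable K b ->
  orth (YL K) ('d K a h - 'd K b h).
Proof. by move=> da db y yL; rewrite innerC innerBr !inner_diff_YL// subrr. Qed.

Lemma orth_remainder a b : differentiable K a ->
  orth (YL K) (K b - K a - 'd K a (b - a)).
Proof.
move=> da y yL; rewrite innerC !innerBr inner_diff_YL//.
have := yL (-1) a b; rewrite scaleN1r (addrC (- a)) => -> /=.
by rewrite /GRing.scale/=; ring.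
Qed.

End NonlinearRange.

(** * Scalar inequalities *)

(* The weights are those for which Bernoulli's inequality
   [p * z <= z `^ p + (p - 1)], at [z = a / (p * zeta * b)], gives the claim
   with [rho = b]. *)
Lemma powR_young (R : realType) (p rho zeta a b : R) : 1 <= p <= 2 ->
  0 < zeta -> 0 <= a -> 0 <= b <= rho ->
  a * b <= rho `^ (2 - p) * p `^ (- p) * zeta `^ (1 - p) * a `^ p
           + (p - 1) * zeta * b ^+ 2.
Proof.
move=> /andP[p1 p2] z0 a0 /andP[b0 br].
(* The cases [p = 1] and [b = 0] are separate: the conjugate exponent [p / (p - 1)] and the ratio
   [z] below divide by zero there. *)
have [->|pn1] := eqVneq p 1.
  rewrite !subrr mul0r mul0r addr0 powRr0 mulr1 powRN powR1 invr1 mulr1 powRr1//.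
  have -> : 2 - 1 = 1 :> R by lra.
  by rewrite powRr1 ?(le_trans b0)// mulrC ler_wpM2r.
have [->|bn0] := eqVneq b 0.
  rewrite mulr0 expr0n /= mulr0 addr0.
  by rewrite !mulr_ge0 ?powR_ge0.
have {pn1}p1 : 1 < p by rewrite lt_def pn1.
have {bn0}b0 : 0 < b by rewrite lt_def bn0.
have p0 : 0 < p by lra.
apply: (@le_trans _ _ (b `^ (2 - p) * p `^ (- p) * zeta `^ (1 - p) * a `^ p
           + (p - 1) * zeta * b ^+ 2)); last first.
  rewrite lerD2r; do 3 (apply: ler_wpM2r; first exact: powR_ge0).
  by apply: ge0_ler_powR; rewrite ?nnegrE; lra.
pose z := a / (p * zeta * b).
have z_ge0 : 0 <= z by rewrite divr_ge0// !mulr_ge0// ltW.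
have aE : a = z * p * zeta * b by rewrite /z; field; rewrite ?gt_eqF.
clearbody z.
have -> : b `^ (2 - p) * p `^ (- p) * zeta `^ (1 - p) * a `^ p =
    zeta * b ^+ 2 * z `^ p.
  rewrite aE !powRM ?mulr_ge0 ?(ltW p0) ?(ltW z0) ?(ltW b0)//.
  rewrite [b `^ (2 - p)]powRD ?(gt_eqF b0) ?implybT//.
  rewrite [zeta `^ (1 - p)]powRD ?(gt_eqF z0) ?implybT//.
  rewrite !powRN powRr1 ?(ltW z0)// powR_mulrn ?(ltW b0)//.
  by field; rewrite ?gt_eqF ?powR_gt0.
(* Young's inequality for the product [z * 1] is Bernoulli's inequality divided by [p]. *)
have := @conjugate_powR R z 1 p (p / (p - 1)) z_ge0 ler01 p0.
rewrite divr_gt0 ?subr_gt0// invf_div powR1 mulr1 => /(_ isT).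
have -> : p^-1 + (p - 1) / p = 1 by field; rewrite gt_eqF.
move=> /(_ erefl) zp.
have {}zp : p * z <= z `^ p + (p - 1).
  rewrite -ler_pdivlMl// mulrC mulrDl; by rewrite mul1r in zp.
have zb : 0 < zeta * b ^+ 2 by rewrite mulr_gt0// exprn_gt0.
rewrite (_ : a * b = zeta * b ^+ 2 * (p * z)); last by rewrite aE; ring.
apply: le_trans (ler_wpM2l (ltW zb) zp) _.
by rewrite le_eqVlt; apply/orP; left; apply/eqP; ring.
Qed.

Lemma linear_growth (R : realType) (eta : nat -> R) (c : R) : 0 <= eta 0%N ->
  (forall i, eta i + c <= eta i.+1) -> forall i, c * i%:R <= eta i.
Proof.
move=> e0 etaS; elim=> [|i IH]; first by rewrite mulr0.
by rewrite -natr1 mulrDr mulr1; apply: le_trans (etaS i); rewrite lerD2r.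
Qed.

(* The weight [1 + A / eta i] is bounded, and it decreases by a multiple of
   [1 / eta i ^+ 2] in each step, which absorbs the growth of [E]. *)
Lemma summable_growth_bounded (R : realType) (E eta : nat -> R) (C c : R) :
  0 <= C -> 0 < c -> (forall i, 0 < eta i) -> (forall i, eta i + c <= eta i.+1) ->
  (forall i, 0 <= E i) ->
  (\forall i \near \oo, E i.+1 * (1 - C / eta i.+1 ^+ 2) <= E i) ->
  exists M, \forall i \near \oo, E i <= M.
Proof.
move=> C0 c0 eta0 etaS E0 [N1 _ EN1].
have eta_ge := linear_growth _ eta c (ltW (eta0 0%N)) etaS.
(* With [A * c = 2 * C], the decrease of the weight pays for [C * eta i] and [C * A] once
   [A <= eta i], which holds from [N2] on. *)
pose A := 2 * C / c.
have A0 : 0 <= A by rewrite divr_ge0 ?mulr_ge0// ltW.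
have AcE : A * c = 2 * C by rewrite /A divfK// gt_eqF.
have [N2 HN2] : exists N, A <= c * N%:R.
  exists (Num.truncn (A / c)).+1; rewrite mulrC -ler_pdivrMr//.
  exact/ltW/truncnS_gt.
pose F i := E i * ((eta i + A) / eta i).
pose N := maxn N1 N2.
have FS i : (N <= i)%N -> F i.+1 <= F i.
  rewrite geq_max => /andP[i1 i2].
  have e0 := eta0 i; have e1 := eta0 i.+1; have eS := etaS i.
  have Ae : A <= eta i.
    apply: le_trans HN2 _; apply: le_trans (eta_ge i).
    by rewrite ler_wpM2l ?ler_nat// ltW.
  apply: (@le_trans _ _ (E i.+1 * (1 - C / eta i.+1 ^+ 2) * ((eta i + A) / eta i))).
    rewrite -mulrA ler_wpM2l// -subr_ge0.
    have -> : (1 - C / eta i.+1 ^+ 2) * ((eta i + A) / eta i) -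
        (eta i.+1 + A) / eta i.+1 =
        (A * eta i.+1 * (eta i.+1 - eta i) - C * (eta i + A)) /
          (eta i * eta i.+1 ^+ 2).
      by field; rewrite !gt_eqF.
    rewrite divr_ge0//; last by rewrite mulr_ge0 ?sqr_ge0// ltW.
    have h1 : A * eta i.+1 * c <= A * eta i.+1 * (eta i.+1 - eta i).
      by apply: ler_wpM2l; [exact: mulr_ge0 A0 (ltW e1) | lra].
    have h2 : C * eta i <= C * eta i.+1 by apply: ler_wpM2l => //; lra.
    have h3 : C * A <= C * eta i by rewrite ler_wpM2l.
    have h4 : A * eta i.+1 * c = 2 * C * eta i.+1 by rewrite mulrAC AcE.
    lra.
  by rewrite ler_wpM2r ?EN1// divr_ge0 ?addr_ge0// ltW.
exists (F N); exists N => // i /= /subnKC <-.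
apply: (@le_trans _ _ (F (N + (i - N))%N)).
  rewrite /F ler_peMr// ler_pdivlMr// mul1r lerDl//.
elim: (i - N)%N => [|k IH]; first by rewrite addn0.
by apply: le_trans IH; rewrite addnS; apply: FS; rewrite leq_addr.
Qed.

(** Completing the square in [psi * nt - eta * RK * ns], after multiplication by [psi]. It serves
    twice: for the coercivity of the energy, and for the coupling of the primal and dual
    increments. *)
Lemma cross_term_bound (R : realType) (kappa RK eta psi ns nt m : R) :
  0 < psi -> 0 <= eta -> RK ^+ 2 <= psi * (1 - kappa) -> `|m| <= RK * ns * nt ->
  2 * eta * m <= psi * nt ^+ 2 + (1 - kappa) * eta ^+ 2 * ns ^+ 2.
Proof.
move=> psi0 eta0 hR hm.
have m1 : 2 * eta * m <= 2 * eta * (RK * ns * nt).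
  by rewrite ler_wpM2l ?mulr_ge0// (le_trans (ler_norm _)).
apply: le_trans m1 _; rewrite -(ler_pM2l psi0) -subr_ge0.
have h := ler_wpM2r (mulr_ge0 (sqr_ge0 eta) (sqr_ge0 ns)) hR.
have := sqr_ge0 (psi * nt - eta * RK * ns); nra.
Qed.

(** One half of [kappa * eta^2 * ns^2] absorbs the [b] term by the bound on [4 * b]; the other half
    completes the square with the [a] term. *)
Lemma quadratic_absorb (R : realType) (kappa eta a b nx ns : R) :
  0 < kappa -> 0 <= eta -> 4 * b <= kappa * eta ->
  2 * eta * (a * nx * ns + b * ns ^+ 2) <=
    kappa * eta ^+ 2 * ns ^+ 2 + 2 * a ^+ 2 / kappa * nx ^+ 2.
Proof.
move=> k0 e0 hb.
have h1 := ler_wpM2r (mulr_ge0 e0 (sqr_ge0 ns)) hb.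
have h2 : 0 <= (kappa * eta * ns - 2 * a * nx) ^+ 2 / (2 * kappa).
  by rewrite divr_ge0 ?sqr_ge0// mulr_ge0// ltW.
have h3 : (kappa * eta * ns - 2 * a * nx) ^+ 2 / (2 * kappa) =
    kappa / 2 * eta ^+ 2 * ns ^+ 2 - 2 * eta * (a * nx * ns)
    + 2 * a ^+ 2 / kappa * nx ^+ 2 by field; rewrite gt_eqF.
rewrite h3 in h2; nra.
Qed.

(** * The energy and its change in one iteration *)

Section Energy.
Context {R : realType} {X Y : hilbertType R}.

(** For linear bounded [A], the quadratic form of the block operator with diagonal [eta^2], [psi]
    and off-diagonal blocks [- eta A] and its adjoint. *)
Definition energy (eta psi : R) (A : X -> Y) (dx : X) (dy : Y) : R :=
  eta ^+ 2 * `|dx| ^+ 2 + psi * `|dy| ^+ 2 - 2 * eta * ⟨A dx, dy⟩.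

Lemma energy_lower (kappa RK eta psi : R) (A : X -> Y) dx dy :
  0 < psi -> 0 <= eta -> RK ^+ 2 <= psi * (1 - kappa) ->
  `|A dx| <= RK * `|dx| -> kappa * eta ^+ 2 * `|dx| ^+ 2 <= energy eta psi A dx dy.
Proof.
move=> psi0 eta0 hR hA; rewrite /energy.
have hm : `|⟨A dx, dy⟩| <= RK * `|dx| * `|dy|.
  by apply: le_trans (cauchy_schwarz _ _) _; rewrite ler_wpM2r.
have := cross_term_bound _ _ _ _ _ _ _ _ psi0 eta0 hR hm; nra.
Qed.

(* [A0], [A1], [Ab] and [Ah] stand for the derivatives of [K] at [x i], [x i.+1],
   the extrapolated point and [xhat], and [r] for the Taylor remainder at the
   extrapolated point. *)
Lemma energy_step (A0 A1 Ab Ah : X -> Y) (dx0 s dx h : X) (dy0 t dy yh r : Y)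
    (eta etan psi omega gG tg theta P lambda G2 c1 c2 : R) :
  linear A0 -> linear A1 -> linear Ab -> linear Ah ->
  dx = dx0 + s -> dy = dy0 + t -> h = dx + omega *: s ->
  0 < etan -> 0 < omega <= 1 -> eta = etan * omega ->
  etan ^+ 2 = eta ^+ 2 + 2 * tg * eta -> 0 <= lambda ->
  gG * `|dx| ^+ 2 <= - eta * ⟨s, dx⟩ - ⟨yh + dy0, A0 dx⟩ + ⟨yh, Ah dx⟩ ->
  etan * G2 <= - psi * ⟨t, dy⟩ + etan * ⟨Ab h - r, dy⟩ ->
  theta * P - lambda / 2 * `|(1 + omega) *: s| ^+ 2 <=
    ⟨yh, A0 h - Ah h⟩ + (gG - tg) * `|h| ^+ 2 ->
  0 <= theta * omega * P + G2 + ⟨r, dy⟩ ->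
  `|⟨yh, A0 s - Ah s⟩| <= c1 * (`|dx| + `|s|) * `|s| ->
  `|⟨Ab dx - A1 dx, dy⟩| <= c2 * omega * `|s| * `|dx| ->
  `|⟨Ab s - A0 s, dy⟩| <= 2 * c2 * `|s| ^+ 2 ->
  energy etan psi A1 dx dy <= energy eta psi A0 dx0 dy0
    - eta ^+ 2 * `|s| ^+ 2 - psi * `|t| ^+ 2 + 2 * eta * ⟨A0 s, t⟩
    + 2 * eta * ((2 * `|gG - tg| + c1 + c2) * `|dx| * `|s|
                 + (`|gG - tg| + c1 + 2 * c2 + 2 * lambda) * `|s| ^+ 2).
Proof.
move=> l0 l1 lb lh dxE dyE hE en0 /andP[om0 om1] etaE en2 lam0 M1 M2 M3 M4 E1 E2 E3.
have lE (A : X -> Y) : linear A -> forall u v a,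
    A (u + a *: v) = A u + a *: A v.
  by move=> lA u v a; rewrite addrC lA addrC.
have dx0E : dx0 = dx - s by rewrite dxE addrK.
have dy0E : dy0 = dy - t by rewrite dyE addrK.
have A0dx : A0 dx0 = A0 dx - A0 s.
  by rewrite dx0E -scaleN1r lE// scaleN1r.
have eta0 : 0 < eta by rewrite etaE mulr_gt0.
rewrite /energy en2 A0dx dx0E dy0E !sqr_normB.
move: M1 M2 M3 E1 E2 E3; rewrite hE dy0E !lE// normrZ exprMn sqr_normD normrZ exprMn.
rewrite !(innerDl, innerDr, innerNl, innerNr, innerZl, innerZr).
rewrite !(innerC yh (A0 _)) !(innerC yh (Ah _)) !(innerC dy (A0 _))
  !(innerC t (A0 _)) (innerC s dx) (innerC t dy).
rewrite (gtr0_norm om0) (_ : `|1 + omega| = 1 + omega); last first.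
  by rewrite gtr0_norm// addr_gt0.
have := cauchy_schwarz dx s.
set nx := `|dx|; set ns := `|s|; set q := gG - tg.
have nx0 : 0 <= nx by rewrite /nx.
have ns0 : 0 <= ns by rewrite /ns.
have eta_ge0 := ltW eta0.
move=> cs M1 M2 M3 E1 E2 E3.
(* [M1] and [M3] are weighted by [eta], [M4] by [etan]. As [eta = etan * omega], the terms in [P],
   [G2] and [⟨r, dy⟩] then cancel in the sum with [M2]. *)
have {}M1 := ler_wpM2l eta_ge0 M1.
have {}M3 := ler_wpM2l eta_ge0 M3.
have {}M4 := mulr_ge0 (ltW en0) M4.
have {}M4 : 0 <= eta * theta * P + etan * G2 + etan * ⟨r, dy⟩.
  by rewrite etaE; move: M4; lra.
have {}M2 : etan * G2 <= - psi * ⟨dy, t⟩ + etan * ⟨Ab dx, dy⟩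
    + eta * ⟨Ab s, dy⟩ - etan * ⟨r, dy⟩ by rewrite etaE; move: M2; lra.
have {}E1 : omega * (⟨A0 s, yh⟩ - ⟨Ah s, yh⟩) <= c1 * (nx + ns) * ns.
  apply: le_trans (ler_norm _) _; rewrite normrM (gtr0_norm om0).
  by apply: le_trans E1; rewrite ler_piMl.
have {}E1 := ler_wpM2l eta_ge0 E1.
have {}E2 : etan * (⟨Ab dx, dy⟩ - ⟨A1 dx, dy⟩) <= eta * (c2 * ns * nx).
  have := ler_wpM2l (ltW en0) (le_trans (ler_norm _) E2); rewrite etaE; lra.
have {}E3 := ler_wpM2l eta_ge0 (le_trans (ler_norm _) E3).
(* The left side is [q * (|h|^2 - |dx|^2)], the price of using (A4) at the extrapolated point. *)
have Q : q * (2 * (omega * ⟨dx, s⟩) + omega ^+ 2 * ns ^+ 2) <=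
    `|q| * (2 * (nx * ns) + ns ^+ 2).
  apply: le_trans (ler_norm _) _; rewrite normrM ler_wpM2l//.
  apply: le_trans (ler_normD _ _) _; apply: lerD.
    rewrite normrM (ger0_norm (ler0n _ _)) ler_wpM2l// normrM (gtr0_norm om0).
    by apply: le_trans cs; rewrite ler_piMl.
  rewrite (ger0_norm (mulr_ge0 (sqr_ge0 _) (sqr_ge0 _))).
  by rewrite ler_piMl ?sqr_ge0// expr_le1// ltW.
have {}Q := ler_wpM2l eta_ge0 Q.
have Lam : lambda / 2 * ((1 + omega) ^+ 2 * ns ^+ 2) <= 2 * lambda * ns ^+ 2.
  have om4 : (1 + omega) ^+ 2 <= 4 by nra.
  have := ler_wpM2l lam0 (ler_wpM2r (sqr_ge0 ns) om4); lra.
have {}Lam := ler_wpM2l eta_ge0 Lam.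
(* The share [q] of the monotonicity is spent on (A4); the share [tg] pays for the growth from
   [eta^2] to [etan^2]. *)
have gGE : gG = q + tg by rewrite /q; ring.
rewrite gGE in M1; clearbody q; lra.
Qed.
End Energy.

(** * Step sizes and the passage to a rate *)

Lemma step_sizes (R : realType) (tau omega : nat -> R) (tg : R) : 0 < tg ->
  0 < tau 0%N -> (forall i, tau i.+1 = tau i * omega i) ->
  (forall i, omega i = 1 / Num.sqrt (1 + 2 * tau i * tg)) ->
  forall i, [/\ 0 < tau i, 0 < omega i <= 1, omega 0%N <= omega i,
    (tau i.+1)^-1 ^+ 2 = (tau i)^-1 ^+ 2 + 2 * tg * (tau i)^-1 &
    (tau i)^-1 + tg * omega 0%N <= (tau i.+1)^-1].
Proof.
move=> tg0 tau00 tauS omegaE.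
have om i : 0 < tau i -> 0 < omega i <= 1.
  move=> ti; have s1 : 1 <= Num.sqrt (1 + 2 * tau i * tg).
    by rewrite -[leLHS]sqrtr1 ler_wsqrtr// lerDl !mulr_ge0// ltW.
  by rewrite omegaE div1r invr_gt0 invf_le1 ?(lt_le_trans ltr01 s1).
have tau0 i : 0 < tau i <= tau 0%N.
  elim: i => [|i /andP[t0 tle]]; first by rewrite tau00 lexx.
  have /andP[om0 om1] := om i t0.
  by rewrite tauS mulr_gt0//= (le_trans _ tle)// ler_piMr// ltW.
move=> i; have /andP[ti tle] := tau0 i; have /andP[oi0 oi1] := om i ti.
have oi : omega 0%N <= omega i.
  rewrite !omegaE !div1r lef_pV2 ?posrE ?sqrtr_gt0 ?ltr_pwDl ?mulr_ge0 ?(ltW tau00) ?(ltW ti) ?(ltW tg0)//.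
  by rewrite ler_wsqrtr// lerD2l ler_wpM2r ?(ltW tg0)// ler_wpM2l.
have sq : (omega i)^-1 ^+ 2 = 1 + 2 * tau i * tg.
  rewrite omegaE div1r invrK sqr_sqrtr//.
  by rewrite addr_ge0// !mulr_ge0// ltW.
have sE : (tau i.+1)^-1 = (tau i)^-1 * (omega i)^-1 by rewrite tauS invfM.
have e2 : (tau i.+1)^-1 ^+ 2 = (tau i)^-1 ^+ 2 + 2 * tg * (tau i)^-1.
  by rewrite sE exprMn sq; field; rewrite gt_eqF.
split=> //; first by rewrite oi0.
move: e2; set e := (tau i)^-1; set d := (tau i.+1)^-1 => e2.
have e0 : 0 < e by rewrite invr_gt0.
have eo : e = d * omega i by rewrite /d sE divfK// gt_eqF.
have d0 : 0 < d by rewrite -(pmulr_lgt0 _ oi0) -eo.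
(* From [e2] and [2 * d * e <= d^2 + e^2] follows [d * e + tg * e <= d^2], and
   [tg * e = d * tg * omega i] dominates [d * tg * omega 0]. *)
rewrite -(ler_pM2l d0) mulrDr.
have h := ler_wpM2l (mulr_ge0 (ltW tg0) (ltW d0)) oi.
have := sqr_ge0 (d - e); nra.
Qed.

Lemma inverse_square_rate (R : realType) (f : nat -> R) (B : R) :
  (forall i, 0 <= f i) -> (\forall i \near \oo, f i <= B / i%:R ^+ 2) ->
  f @ \oo --> (0 : R) /\
  ((f : nat -> R^o) =O_\oo (fun N : nat => 1 / N%:R ^+ 2 : R^o)).
Proof.
move=> f0 fB; split.
  have c1 : (fun i : nat => B * (i%:R^-1 * i%:R^-1)) @ \oo --> (0 : R).
    rewrite -(mulr0 B) -[X in B * X](mulr0 0); apply: cvgM; first exact: cvg_cst.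
    have h : (fun i : nat => i%:R^-1 : R) @ \oo --> (0 : R).
      by rewrite -(cvg_shiftS _); exact: cvg_harmonic.
    exact: cvgM.
  apply: (squeeze_cvgr _ (cvg_cst 0) c1).
  near=> i; rewrite f0 -invfM -expr2; by near: i.
(* The sign of [B] is unknown, and the constant has to be positive. *)
apply/eqO_exP; exists (`|B| + 1); first by rewrite ltr_wpDl.
near=> i; rewrite (ger0_norm (f0 i)).
have i2 : 0 <= 1 / i%:R ^+ 2 :> R by rewrite divr_ge0 ?sqr_ge0.
rewrite [X in _ <= _ * X]ger0_norm//.
apply: (@le_trans _ _ (B / i%:R ^+ 2)); first by near: i.
rewrite -[in leLHS](mulr1 B) -mulrA ler_wpM2r//.
by rewrite (le_trans (ler_norm _))// lerDl.
Unshelve. all: by end_near. Qed.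

(** * The convergence theorem *)

Theorem theorem4p3 (R : realType) (X Y : hilbertType R)
  (G : X -> \bar R) (Fs : Y -> \bar R) (K : X -> Y)
  (properG : proper_efun G) (convexG : convex_efun G) (lscG : lower_semicontinuous G)
  (properFs : proper_efun Fs) (convexFs : convex_efun Fs)
  (lscFs : lower_semicontinuous Fs)
  (C1K : C1 K)
  (xhat : X) (yhat : Y) (zero_hat : saddle_zeros G Fs K (xhat, yhat))
  (XK XG : set X) (YF : set Y)
  (nbhsXK : nbhs xhat XK) (nbhsXG : nbhs xhat XG) (nbhsYF : nbhs yhat YF)
  (gammaG tgammaG gammaL gammaNL : R)
  (gammaG_ge0 : 0 <= gammaG) (tgammaG_gt0 : 0 < tgammaG)
  (gammaL_ge0 : 0 <= gammaL) (gammaNL_ge0 : 0 <= gammaNL)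
  (L RK lambda theta p rho : R)
  (L_ge0 : 0 <= L) (RK_gt0 : 0 < RK) (lambda_ge0 : 0 <= lambda)
  (theta_ge0 : 0 <= theta) (p12 : 1 <= p <= 2) (rho_ge0 : 0 <= rho)
  (tau sigma omega : nat -> R) (x : nat -> X) (y : nat -> Y)
  (algorithm : NL_PDHGM G Fs K tau sigma omega x y)
  (A1 : forall x1 x2 : X, XK x1 -> XK x2 ->
     (opnorm ('d K x1 \- 'd K x2)%R <= (L * `|x1 - x2|)%:E)%E)
  (A2 : (ereal_sup [set opnorm ('d K z) | z in XK] <= RK%:E)%E)
  (A3G : strongly_monotone (subdiff G) (fun v => gammaG *: v)
     xhat (- adjoint ('d K xhat) yhat) XG)
  (A3F : strongly_monotone (subdiff Fs)
     (fun v => gammaL *: PL K v + gammaNL *: PNL K v)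
     yhat (K xhat) YF)
  (A4 : forall x1 x2 : X, XK x1 -> XK x2 ->
     ⟨adjoint ('d K x2 \- 'd K xhat) yhat, x1 - xhat⟩
       + (gammaG - tgammaG) * `|x1 - xhat| ^+ 2
     >= theta * (`|K xhat - K x1 - 'd K x1 (xhat - x1)| `^ p)
        - lambda / 2 * `|x1 - x2| ^+ 2)
  (A5 : forall i : nat,
     ((XG `&` XK) `*` (ballNL K yhat rho `&` YF)) (x i, y i) /\
     XK (xbar omega x i))
  (tauS : forall i : nat, tau i.+1 = tau i * omega i)
  (sigmaS : forall i : nat, sigma i.+1 = sigma i / omega i)
  (omegaE : forall i : nat,
     omega i = 1 / Num.sqrt (1 + 2 * tau i * tgammaG))
  (delta kappa : R)
  (delta_gt0 : 0 < delta) (delta_le : delta <= kappa) (kappa_lt1 : kappa < 1)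
  (tau0_gt0 : 0 < tau 0%N)
  (tau0_le : 3 * L * rho + lambda != 0 ->
     tau 0%N <= delta / (3 * L * rho + lambda))
  (tausigma0 : 0 < tau 0%N * sigma 0%N <= (1 - kappa) / RK ^+ 2)
  (zeta : R) (zeta_gt0 : 0 < zeta)
  (gammaNL_ge : gammaNL >= (p - 1) * zeta)
  (theta_ge : theta >= (rho `^ (2 - p)) * (p `^ (- p))
     * Num.sqrt (1 + 2 * tau 0%N * tgammaG) * (zeta `^ (1 - p))) :
  ((fun N : nat => `|x N - xhat| ^+ 2) @ \oo --> (0 : R)) /\
  ((fun N : nat => `|x N - xhat| ^+ 2 : R^o)
     =O_\oo (fun N : nat => 1 / N%:R ^+ 2 : R^o)).
Proof.
have [diffK _] := C1K.
pose dx i := x i - xhat.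
pose dy i := y i - yhat.
pose s i := x i.+1 - x i.
pose t i := y i.+1 - y i.
pose xb i := xbar omega x i.
pose eta i := (tau i)^-1.
pose psi := (tau 0%N * sigma 0%N)^-1.
pose r i := K xhat - K (xb i) - 'd K (xb i) (xhat - xb i).
have ss := step_sizes _ _ _ _ tgammaG_gt0 tau0_gt0 tauS omegaE.
have /andP[tausigma_gt0 tausigma_le] := tausigma0.
have psi0 : 0 < psi by rewrite invr_gt0.
have eta0 i : 0 < eta i by have [? _ _ _ _] := ss i; rewrite invr_gt0.
have etaE i : eta i = eta i.+1 * omega i.
  have [ti /andP[oi _] _ _ _] := ss i.
  by rewrite /eta tauS invfM divfK// gt_eqF.
have psiE i : psi = eta i / sigma i.
  rewrite /psi /eta -invfM; congr (_^-1).
  elim: i => // i ->; have [_ /andP[oi _] _ _ _] := ss i.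
  by rewrite tauS sigmaS; field; rewrite gt_eqF.
have XKhat : XK xhat := nbhs_singleton nbhsXK.
have XKx i : XK (x i) by have [[[_ ?] _] _] := A5 i.
have XKb i : XK (xb i) by have [_ ?] := A5 i.
have ld a : linear ('d K a) by exact: linearP.
have cd a : continuous ('d K a) by exact: diff_continuous.
have dK_le a v : XK a -> `|'d K a v| <= RK * `|v|.
  move=> Xa; apply: opnorm_bound; first exact: ld.
  by apply: le_trans A2; apply: ereal_sup_ubound; exists a.
have dKB a b v : XK a -> XK b -> `|'d K a v - 'd K b v| <= L * `|a - b| * `|v|.
  move=> Xa Xb; apply: (opnorm_bound ('d K a \- 'd K b) _ _ (A1 _ _ Xa Xb)).
  exact: linear_subr.
(* The factor is [rho] and not [|dy i|]: the derivative difference is orthogonal to [YL], so it sees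
   only the [YNL] component of [dy i]. *)
have dKB_inner a b v i : XK a -> XK b ->
    `|⟨'d K a v - 'd K b v, dy i⟩| <= L * rho * `|a - b| * `|v|.
  move=> Xa Xb; apply: le_trans (inner_orth_YL _ _ _ _) _; first exact: orth_diffB.
  have [[_ [bi _]] _] := A5 i.
  have := ler_pM (normr_ge0 _) (normr_ge0 _) (dKB a b v Xa Xb) (ballNL_norm _ _ _ _ bi).
  by move=> h; apply: le_trans h _; lra.
pose q := `|gammaG - tgammaG|.
pose c1 := `|yhat| * L.
pose c2 := L * rho.
pose a := 2 * q + c1 + c2.
pose b := q + c1 + 2 * c2 + 2 * lambda.
pose En i := energy (eta i) psi ('d K (x i)) (dx i) (dy i).
have step i : En i.+1 <= En i
    - eta i ^+ 2 * `|s i| ^+ 2 - psi * `|t i| ^+ 2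
    + 2 * eta i * ⟨'d K (x i) (s i), t i⟩
    + 2 * eta i * (a * `|dx i.+1| * `|s i| + b * `|s i| ^+ 2).
  have [ti oi o0i e2 _] := ss i; have /andP[oi0 oi1] := oi.
  have dxS : dx i.+1 = dx i + s i by rewrite /dx /s [RHS]addrC addrA subrK.
  have dyS : dy i.+1 = dy i + t i by rewrite /dy /t [RHS]addrC addrA subrK.
  pose h := dx i.+1 + omega i *: s i.
  have hE : h = xb i - xhat by rewrite /h /xb /xbar /dx addrAC.
  have dbE : 'd K (xb i) h = - 'd K (xb i) (xhat - xb i).
    by rewrite hE -linearN opprB.
  have xbx : xb i - x i = (1 + omega i) *: s i.
    by rewrite scalerDl scale1r /xb /xbar addrAC.
  have xbxS : xb i - x i.+1 = omega i *: s i by rewrite /xb /xbar addrC addKr.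
  have [_ [[g Gg gE] [f Ff fE]]] := algorithm i.
  have [[[XGS _] [ballS YFS]] _] := A5 i.+1.
  have := @energy_step R X Y ('d K (x i)) ('d K (x i.+1)) ('d K (xb i)) ('d K xhat)
    (dx i) (s i) (dx i.+1) h (dy i) (t i) (dy i.+1) yhat (r i)
    (eta i) (eta i.+1) psi (omega i) gammaG tgammaG theta (`|r i| `^ p) lambda
    (gammaNL * `|PNL K (dy i.+1)| ^+ 2) c1 c2.
  apply=> //.
  - have [_ /(_ _ _ XGS Gg)] := A3G.
    rewrite /sqnorm innerZl innervv => h1; apply: le_trans h1 _.
    (* The resolvent equation solved for the subgradient at the new iterate. *)
    have gE' : g = (- eta i) *: s i - adjoint ('d K (x i)) (y i).
      apply: (scalerI (lt0r_neq0 ti)).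
      rewrite scalerBr scalerA mulrN mulfV ?lt0r_neq0// scaleN1r.
      by rewrite -[LHS](addKr (x i.+1)) -gE /s opprB addrA; congr (_ - _); rewrite addrC.
    have -> : yhat + dy i = y i by rewrite /dy addrC subrK.
    rewrite opprK -/(dx i.+1) gE' innerDl innerBl innerZl !adjointE//.
  - have G2 : gammaNL * `|PNL K (dy i.+1)| ^+ 2 <= ⟨f - K xhat, dy i.+1⟩.
      have [_ /(_ _ _ YFS Ff)] := A3F; apply: le_trans.
      rewrite /sqnorm [leRHS]innerDl !innerZl sqnorm_PNL.
      by rewrite lerDr mulr_ge0// sqnorm_PL_ge0.
    have -> : 'd K (xb i) h - r i = K (xb i) - K xhat.
      by rewrite dbE /r (opprB (_ - _)) addKr opprB.
    apply: le_trans (ler_wpM2l (ltW (eta0 _)) G2) _.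
    have fE' : f = (sigma i.+1)^-1 *: (- t i) + K (xb i).
      have [_ si _] := (algorithm i).1.
      apply: (scalerI (lt0r_neq0 si)).
      rewrite scalerDr scalerA mulfV ?lt0r_neq0// scale1r.
      by rewrite -[LHS](addKr (y i.+1)) -fE /t opprB addrA; congr (_ + _); rewrite addrC.
    have -> : ⟨f - K xhat, dy i.+1⟩ =
        - (sigma i.+1)^-1 * ⟨t i, dy i.+1⟩ + ⟨K (xb i) - K xhat, dy i.+1⟩.
      by rewrite fE' -addrA [LHS]innerDl innerZl innerNl mulrN mulNr.
    rewrite (psiE i.+1); by rewrite le_eqVlt; apply/orP; left; apply/eqP; ring.
  (* The second point is [x i] because the primal step uses the derivative there. *)
  - have := A4 _ _ (XKb i) (XKx i).
    rewrite -hE xbx adjointE//; first exact: linear_subr.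
    by move=> z; apply: cvgB; exact: cd.
  - have [[_ [bi _]] _] := A5 i.+1.
    have b0 : 0 <= `|PNL K (dy i.+1)| <= rho.
      by rewrite normr_ge0/=; exact: ballNL_norm bi.
    have yo := powR_young _ _ _ _ _ _ p12 zeta_gt0 (normr_ge0 (r i)) b0.
    have ro := inner_orth_YL K _ (dy i.+1) (orth_remainder K (xb i) xhat (diffK _)).
    (* The square root in the lower bound on [theta] is [1 / omega 0], and [omega 0 <= omega i]. *)
    have th1 : rho `^ (2 - p) * p `^ (- p) * zeta `^ (1 - p) <= theta * omega i.
      apply: le_trans (ler_wpM2l theta_ge0 o0i).
      rewrite omegaE mul1r ler_pdivlMr; last first.
        by rewrite sqrtr_gt0 ltr_wpDr// !mulr_ge0// ltW.
      by rewrite mulrAC.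
    have := ler_wpM2r (powR_ge0 `|r i| p) th1.
    have := ler_wpM2r (sqr_ge0 `|PNL K (dy i.+1)|) gammaNL_ge.
    move: ro; rewrite ler_norml -/(r i) => /andP[ro _]; lra.
  - apply: le_trans (cauchy_schwarz _ _) _; rewrite -2!mulrA ler_wpM2l//.
    apply: le_trans (dKB _ _ _ (XKx i) XKhat) _.
    rewrite mulrA ler_wpM2r// ler_wpM2l// -/(dx i).
    have -> : dx i = dx i.+1 - s i by rewrite dxS addrK.
    exact: ler_normB.
  - apply: le_trans (dKB_inner _ _ _ _ (XKb i) (XKx i.+1)) _.
    by rewrite xbxS normrZ gtr0_norm// mulrA.
  - apply: le_trans (dKB_inner _ _ _ _ (XKb i) (XKx i)) _.
    rewrite xbx normrZ gtr0_norm ?addr_gt0// -/c2.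
    have o2 : 1 + omega i <= 2 by lra.
    have := ler_wpM2l (mulr_ge0 L_ge0 rho_ge0) (ler_wpM2r (sqr_ge0 `|s i|) o2).
    rewrite -/c2; lra.
have kappa0 : 0 < kappa by exact: lt_le_trans delta_le.
have RKpsi : RK ^+ 2 <= psi * (1 - kappa).
  rewrite /psi -ler_pdivrMl ?invr_gt0// invrK.
  by move: tausigma_le; rewrite ler_pdivlMr ?exprn_gt0// mulrC.
have En_lower i : kappa * eta i ^+ 2 * `|dx i| ^+ 2 <= En i.
  apply: energy_lower (dK_le _ _ (XKx i)) => //; exact: ltW.
have En0 i : 0 <= En i.
  by apply: le_trans (En_lower i); rewrite !mulr_ge0 ?sqr_ge0// ltW.
pose c := tgammaG * omega 0%N.
have c0 : 0 < c.
  by have [_ /andP[om0 _] _ _ _] := ss 0%N; rewrite mulr_gt0.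
have etaS i : eta i + c <= eta i.+1 by have [] := ss i.
have eta_ge := linear_growth _ eta c (ltW (eta0 0%N)) etaS.
pose C := 2 * a ^+ 2 / kappa.
have C0 : 0 <= C.
  exact: divr_ge0 (mulr_ge0 (ler0n _ _) (sqr_ge0 _)) (ltW kappa0).
have growth : \forall i \near \oo,
    En i.+1 * (1 - C / kappa / eta i.+1 ^+ 2) <= En i.
  near=> i.
  have ib : 4 * b <= kappa * eta i.
    rewrite -ler_pdivrMl//; apply: le_trans (eta_ge i).
    rewrite -ler_pdivrMl//; near: i; exact: nbhs_infty_ger.
  (* The coupling uses up [psi * |t i|^2] and the share [1 - kappa] of [eta i^2 * |s i|^2]; the
     remaining share [kappa] is left for the errors in [quad]. *)
  have cross := cross_term_bound _ kappa RK (eta i) psi `|s i| `|t i|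
    ⟨'d K (x i) (s i), t i⟩ psi0 (ltW (eta0 i)) RKpsi.
  have {}cross := cross (le_trans (cauchy_schwarz _ _)
    (ler_wpM2r (normr_ge0 _) (dK_le _ (s i) (XKx i)))).
  have quad := quadratic_absorb _ kappa (eta i) a b `|dx i.+1| `|s i|
    kappa0 (ltW (eta0 i)) ib.
  have inc : En i.+1 <= En i + C * `|dx i.+1| ^+ 2.
    by have := step i; rewrite /C; lra.
  have dxE : C * `|dx i.+1| ^+ 2 <= En i.+1 * (C / kappa / eta i.+1 ^+ 2).
    have k0 : 0 <= C / kappa / eta i.+1 ^+ 2.
      exact: divr_ge0 (divr_ge0 C0 (ltW kappa0)) (sqr_ge0 _).
    have := ler_wpM2r k0 (En_lower i.+1).
    apply: le_trans; rewrite le_eqVlt; apply/orP; left; apply/eqP.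
    by field; rewrite !gt_eqF.
  by rewrite mulrBr mulr1; lra.
have [M EM] := summable_growth_bounded _ _ eta (C / kappa) c
  (divr_ge0 C0 (ltW kappa0)) c0 eta0 etaS En0 growth.
(* The constant comes from [kappa * (c * i)^2 * |dx i|^2 <= En i <= M]. *)
apply: (inverse_square_rate _ _ (M / (kappa * c ^+ 2))).
  by move=> i; exact: sqr_ge0.
near=> i.
have i0 : 0 < i%:R :> R by rewrite ltr0n; near: i; exact: nbhs_infty_gt.
rewrite (ler_pdivlMr _ _ (exprn_gt0 2 i0)).
rewrite (ler_pdivlMr _ _ (mulr_gt0 kappa0 (exprn_gt0 2 c0))).
have EMi : En i <= M by near: i.
apply: le_trans EMi; apply: le_trans (En_lower i).
have ci : (c * i%:R) ^+ 2 <= eta i ^+ 2.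
  have ci0 : 0 <= c * i%:R := mulr_ge0 (ltW c0) (ltW i0).
  by rewrite lerXn2r// nnegrE ltW.
have := ler_wpM2l (mulr_ge0 (ltW kappa0) (sqr_ge0 `|dx i|)) ci.
rewrite -/(dx i); lra.
Unshelve. all: by end_near. Qed.
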